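(* Let $k=(1,-1,1,1,1,-1,1,-1,-1,1,-1,1,1,1,-1,1,-1,1)\in\{\pm1\}^{18}$. Then $p_k\in\mathcal{S}$, this polynomial is given explicitly by $$p_k(\lambda)=\lambda^{18}-4\lambda^{16}+5\lambda^{14}-4\lambda^{12}+7\lambda^{10}-8\lambda^8+6\lambda^6-4\lambda^4+\lambda^2,$$ and $K(p_k)\not\subset\overline{U(p_k)}$.
   Context: For $k=(k_1,\dots,k_n)\in\{\pm1\}^n$ and $1\le i\le j\le n$, let $k(i:j):=(k_i,\dots,k_j)$ and let $q_{k(i:j)}(\lambda)$ be the determinant of the tridiagonal matrix of order $j-i+2$ with all main diagonal entries equal to $\lambda$, all entries on the first superdiagonal equal to $1$, and first subdiagonal entries $k_i,\dots,k_j$ (from top to bottom). Further set $q_{k(i:j)}(\lambda):=\lambda$ if $i-j=1$, $:=1$ if $i-j=2$, and $:=0$ if $i-j=3$. For $k\in\{\pm1\}^n$ the polynomial $p_k$ is defined by $(-1)^n p_k(\lambda)=q_{k(1:n-1)}(-\lambda)-k_n\,q_{k(2:n-2)}(-\lambda)$. $\mathcal{S}$ denotes the set of those polynomials $p_k$, with $k\in\{\pm1\}^n$ for some $n\ge2$, for which: (i) $k_{n-1}=-1$ and $k_n=1$; (ii) $p_k=p_{\widehat k}$, where $\widehat k$ is identical to $k$ but with the last two entries interchanged. For a polynomial $p$ of degree $\ge2$, $p^n$ is the $n$-fold composition of $p$ with itself and $p^{-n}(\cdot)$ denotes preimage under $p^n$. The filled Julia set $K(p)$ is the set of $\lambda\in\mathbb{C}$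 for which $(p^n(\lambda))_{n\in\mathbb{N}}$ is bounded. $U(p):=\bigcup_{n=1}^\infty p^{-n}(\mathbb{D})$, where $\mathbb{D}:=\{\lambda\in\mathbb{C}:|\lambda|<1\}$. *)

(* Defs.v *)
From HB Require Import structures.
From mathcomp Require Import all_boot all_order all_algebra.
From mathcomp Require Import all_classical all_reals all_analysis.
From mathcomp Require Import complex.
Import numFieldNormedType.Exports.

Set Implicit Arguments.
Unset Strict Implicit.
Unset Printing Implicit Defensive.

Import Order.TTheory GRing.Theory Num.Theory.
Local Open Scope classical_set_scope.
Local Open Scope ring_scope.
Local Open Scope complex_scope.

(* The norm topology on R[i]. *)
#[warnings="-redundant-canonical-projection"]
HB.instance Definition _ (R : realType) :=
  NormedModule.copy (R[i]) ((R[i])^o).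

(* Sign vectors (k_1, ..., k_n) are represented by lists of integers; the
   indices are 1-based, and entry k i is the junk value 0 for i > n. *)
Definition sign_vector (n : nat) (k : seq int) : Prop :=
  size k = n /\ forall x : int, x \in k -> x = 1 \/ x = -1.

Definition entry (k : seq int) (i : nat) : int := nth 0 k i.-1.

(* 0-based position (a, a-1) below the diagonal carries k_(i+a-1). *)
Definition tridiag (F : comNzRingType) (k : seq int) (i m : nat) :
    'M[{poly F}]_m :=
  \matrix_(a < m, b < m)
    if a == b then 'X
    else if (b == a.+1 :> nat) then 1
    else if (a == b.+1 :> nat) then (entry k (i + b))%:~R
    else 0.

(* The upper index j is an integer because p_k uses j = n - 2, which is
   negative for n = 1. *)
Definition q_poly (F : comNzRingType) (k : seq int) (i : nat) (j : int) :
    {poly F} :=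
  if i%:Z - j == 1 then 'X
  else if i%:Z - j == 2 then 1
  else if i%:Z - j == 3 then 0
  else \det (tridiag F k i (absz (j - i%:Z + 2))).

(* (-1)^n p_k(x) = q_{k(1:n-1)}(-x) - k_n q_{k(2:n-2)}(-x) solved for p_k. *)
Definition p_poly (F : comNzRingType) (k : seq int) : {poly F} :=
  let n := size k in
  (-1) ^+ n *:
    (q_poly F k 1 (n%:Z - 1) \Po (- 'X)
     - (entry k n)%:~R *: (q_poly F k 2 (n%:Z - 2) \Po (- 'X))).

(* k with its last two entries interchanged, for k of length at least 2. *)
Definition hat (k : seq int) : seq int :=
  let n := size k in rcons (rcons (take n.-2 k) (entry k n)) (entry k n.-1).

Definition calS (F : comNzRingType) : set {poly F} :=
  [set p | exists (n : nat) (k : seq int),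
     [/\ (2 <= n)%N, sign_vector n k,
         entry k n.-1 = -1 /\ entry k n = 1,
         p_poly F k = p_poly F (hat k) & p = p_poly F k]].

Arguments calS F : clear implicits.

Definition poly_iter (F : comNzRingType) (p : {poly F}) (n : nat) : F -> F :=
  iter n (fun z => p.[z]).

Definition filled_julia (R : realType) (p : {poly R[i]}) : set R[i] :=
  [set z | bounded_fun (fun n : nat => poly_iter p n z)].

Definition unit_disc (R : realType) : set R[i] := [set z | `|z| < 1].

Arguments unit_disc R : clear implicits.

Definition U_set (R : realType) (p : {poly R[i]}) : set R[i] :=
  \bigcup_(n in [set n : nat | (1 <= n)%N]) (poly_iter p n @^-1` unit_disc R).

(* Main.v *)
(* Besides 0, the polynomial p has an attracting fixed point near 1.21544, with
   multiplier about -0.69. Hence p maps the closed disc of radius 1/500 around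
   79/65 into itself. The orbit of every point of this disc is bounded and stays
   outside the unit disc, so the centre lies in K(p) and has a neighbourhood
   disjoint from U(p). The determinants defining p are continuants, whose
   coefficient lists are computed by the three-term recurrence. *)
Require Import Defs.
From HB Require Import structures.
From mathcomp Require Import all_boot all_order all_algebra.
From mathcomp Require Import all_classical all_reals all_analysis.
From mathcomp Require Import complex.
From mathcomp Require Import zify ring lra.
Import numFieldNormedType.Exports.
Import Order.TTheory GRing.Theory Num.Theory.
Local Open Scope classical_set_scope.
Local Open Scope ring_scope.
Local Open Scope complex_scope.

(** Laplace expansion along the first row leaves two minors. The second has [nth 0 k i] as the only
    nonzero candidate in its first column and is expanded along that column. *)
Lemma det_tridiag_rec (F : comNzRingType) (k : seq int) (i m : nat) :
  \det (tridiag F k i.+1 m.+2) =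
  'X * \det (tridiag F k i.+2 m.+1) - (nth 0 k i)%:~R * \det (tridiag F k i.+3 m).
Proof.
rewrite (expand_det_row _ ord0) big_ord_recl big_ord_recl big1 ?addr0; last first.
  by move=> j _; rewrite !mxE /= mul0r.
congr (_ + _).
  rewrite /cofactor !mxE /= expr0 mul1r; congr (_ * \det _).
  apply/matrixP => a b; rewrite !mxE (inj_eq lift_inj) !lift0 !eqSS.
  by rewrite -addSnnS.
rewrite /cofactor !mxE /= mul1r expr1 mulN1r; congr (- _).
rewrite (expand_det_col _ ord0) big_ord_recl big1 ?addr0; last first.
  by move=> j _; rewrite !mxE /= mul0r.
rewrite /cofactor !mxE /= expr0 mul1r /entry addn0; congr (_ * \det _).
apply/matrixP => a b; rewrite !mxE.
rewrite -!(inj_eq val_inj) /= /bump !leq0n /= !add1n !eqSS.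
by rewrite -!addSnnS.
Qed.

(** Integer coefficients, constant term first: identities between polynomials over [F] then reduce
    to closed computations on integer lists. *)
Definition ipoly (F : nzRingType) (s : seq int) : {poly F} :=
  Poly [seq x%:~R | x <- s].
Arguments ipoly F s : clear implicits.

Lemma ipoly_cons (F : nzRingType) (a : int) (s : seq int) :
  ipoly F (a :: s) = ipoly F s * 'X + a%:~R.
Proof. by rewrite /ipoly /= cons_poly_def rmorph_int. Qed.

Fixpoint sub_coefs (c : int) (s t : seq int) : seq int :=
  match s, t with
  | [::], _ => [seq - (c * x) | x <- t]
  | _, [::] => s
  | a :: s', b :: t' => (a - c * b) :: sub_coefs c s' t'
  end.

Lemma ipoly_sub (F : comNzRingType) (c : int) (s t : seq int) :
  ipoly F (sub_coefs c s t) = ipoly F s - c%:~R * ipoly F t.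
Proof.
have nil : ipoly F [::] = 0 by [].
have scale u : ipoly F [seq - (c * x) | x <- u] = - (c%:~R * ipoly F u).
  by elim: u => [|a u IH] /=; rewrite ?ipoly_cons ?nil ?IH; ring.
by elim: s t => [|a s IH] [|b t] /=; rewrite ?ipoly_cons ?scale ?nil ?IH; ring.
Qed.

Fixpoint reflect_coefs (s : seq int) : seq int :=
  if s is a :: s' then a :: [seq - x | x <- reflect_coefs s'] else [::].

Lemma ipoly_reflect (F : comNzRingType) (s : seq int) :
  ipoly F s \Po (- 'X) = ipoly F (reflect_coefs s).
Proof.
have ipolyN t : ipoly F [seq - x | x <- t] = - ipoly F t.
  elim: t => [|a t IH]; first by rewrite /ipoly /= oppr0.
  by rewrite /= !ipoly_cons IH; ring.
elim: s => [|a s IH]; first by rewrite /ipoly /= comp_poly0.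
rewrite /= !ipoly_cons ipolyN -IH comp_polyD comp_polyM comp_polyX.
by rewrite -(rmorph_int polyC) comp_polyC; ring.
Qed.

(* The first component belongs to [k], the second to [behead k] ([1], the empty
   determinant, when [k] is empty). *)
Definition continuant (k : seq int) : seq int * seq int :=
  foldr (fun c uv => (sub_coefs c (0 :: uv.1) uv.2, uv.1)) ([:: 0; 1], [:: 1]) k.

(** The recurrence has three terms, so the induction carries two consecutive determinants. The list
    [s] is a window of [k] that starts at offset [i]. *)
Lemma det_tridiag (F : comNzRingType) (k s : seq int) (i : nat) :
  (forall j, (j < size s)%N -> nth 0 s j = nth 0 k (i + j)) ->
  \det (tridiag F k i.+1 (size s).+1) = ipoly F (continuant s).1 /\
  \det (tridiag F k i.+2 (size s)) = ipoly F (continuant s).2.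
Proof.
elim: s i => [|c s IH] i eq_sk.
  rewrite det_mx00 det_mx11 mxE /= /ipoly /= !cons_poly_def.
  by split; ring.
have /IH[IH1 IH2] j : (j < size s)%N -> nth 0 s j = nth 0 k (i.+1 + j).
  by move=> lt_js; rewrite addSnnS -eq_sk.
rewrite det_tridiag_rec IH1 IH2 /= (ipoly_sub _ _ (0 :: _)) ipoly_cons.
by have /= -> := eq_sk 0%N isT; rewrite addn0; split=> //; ring.
Qed.

(** The outer [sub_coefs] with [[::]] is multiplication by [(-1) ^+ n]. The two [take] lists are
    k(1:n-1) and k(2:n-2). *)
Definition p_coefs (k : seq int) : seq int :=
  let n := size k in
  sub_coefs (- (-1) ^+ n) [::]
    (sub_coefs (entry k n) (reflect_coefs (continuant (take n.-1 k)).1)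
       (reflect_coefs (continuant (take (n - 3) (behead k))).1)).

Lemma q_poly_det (F : comNzRingType) (k : seq int) (i : nat) (j : int) :
  i%:Z <= j -> q_poly F k i j = \det (tridiag F k i (absz (j - i%:Z + 2))).
Proof.
move=> le_ij; rewrite /q_poly.
by case: eqP => [|_]; [lia|]; case: eqP => [|_]; [lia|]; case: eqP => [|_]; [lia|].
Qed.

(** Length at least 4 gives 2 <= n - 2, so both [q_poly] terms are genuine determinants rather than
    boundary values. *)
Lemma p_polyE (F : comNzRingType) (k : seq int) (m : nat) : size k = m.+4 ->
  p_poly F k = ipoly F (p_coefs k).
Proof.
move=> def_n; rewrite /p_poly /p_coefs def_n !subSS subn0 !ipoly_sub.
rewrite -!ipoly_reflect.
have s1 : size (take m.+3 k) = m.+3 by rewrite size_takel // def_n.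
have s2 : size (take m.+1 (behead k)) = m.+1.
  by rewrite size_takel ?size_behead ?def_n /=; lia.
have /(@det_tridiag F)[<- _] j : (j < size (take m.+3 k))%N ->
    nth 0 (take m.+3 k) j = nth 0 k (0 + j).
  by rewrite s1 => ltj; rewrite nth_take.
have /(@det_tridiag F)[<- _] j : (j < size (take m.+1 (behead k)))%N ->
    nth 0 (take m.+1 (behead k)) j = nth 0 k (1 + j).
  by rewrite s2 => ltj; rewrite nth_take // nth_behead.
rewrite s1 s2 !q_poly_det; [|lia..].
have -> : absz (m.+4%:Z - 1 - 1%N%:Z + 2) = m.+4 by lia.
have -> : absz (m.+4%:Z - 2 - 2%N%:Z + 2) = m.+2 by lia.
rewrite -!mul_polyC rmorphXn rmorphN rmorph1 rmorph_int.
by rewrite /ipoly /= rmorphN rmorphXn rmorphN !rmorph1; ring.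
Qed.

Lemma normc_real (R : rcfType) (x : R) : `|x%:C| = `|x|%:C.
Proof. by rewrite normc_def /= expr0n addr0 sqrtr_sqr. Qed.

(** Iterating this along a Horner scheme bounds a polynomial with real coefficients on a complex
    disc of radius [rho]. *)
Lemma normc_horner_step (R : rcfType) (h t : R[i]) (a rho M M' : R) :
  `|h| <= rho%:C -> `|t| <= M%:C -> `|a| + rho * M <= M' ->
  `|a%:C + h * t| <= M'%:C.
Proof.
move=> le_h le_t le_M; apply: (@le_trans _ _ (`|a| + rho * M)%:C).
  rewrite rmorphD rmorphM (le_trans (ler_normD _ _)) // normrM normc_real.
  by rewrite lerD2l ler_pM.
by rewrite lecR.
Qed.

Definition p18 (R : realType) : {poly R[i]} :=
  'X^18 - 4 *: 'X^16 + 5 *: 'X^14 - 4 *: 'X^12 + 7 *: 'X^10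
          - 8 *: 'X^8 + 6 *: 'X^6 - 4 *: 'X^4 + 'X^2.

Lemma p18E (R : realType) (z : R[i]) :
  (p18 R).[z] = z ^+ 18 - 4 * z ^+ 16 + 5 * z ^+ 14 - 4 * z ^+ 12 + 7 * z ^+ 10
            - 8 * z ^+ 8 + 6 * z ^+ 6 - 4 * z ^+ 4 + z ^+ 2.
Proof. by rewrite /p18 !(hornerD, hornerN, hornerZ, hornerXn). Qed.

Definition near_fixpoint (R : realType) : R := 79%:R / 65%:R.

(* Write [p18.[z] = q.[z ^+ 2]]. The fractions below are the Taylor coefficients
   of [q - c] at 65/44, a point close to both [c ^+ 2] and the square of the
   fixed point. *)
Lemma p18_trap (R : realType) (z : R[i]) :
  let c := near_fixpoint R in
  `|z - c%:C| <= (500%:R^-1)%:C -> `|(p18 R).[z] - c%:C| <= (500%:R^-1)%:C.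
Proof.
move=> c le_zc; pose h := z ^+ 2 - (65%:R / 44%:R : R)%:C.
have le_h : `|h| <= (200%:R^-1)%:C.
  have -> : h = (c ^+ 2 - 65%:R / 44%:R)%:C
                + (z - c%:C) * ((2 * c)%:C + (z - c%:C) * 1).
    by rewrite /h; ring.
  (* 244/100 is a rounded upper bound for 2c + 1/500. *)
  apply: (@normc_horner_step _ _ _ _ _ (244%:R / 100%:R) _ le_zc).
    apply: (@normc_horner_step _ _ _ _ _ 1 _ le_zc); first by rewrite normr1.
    by rewrite /c /near_fixpoint ger0_norm; lra.
  by rewrite /c /near_fixpoint ler0_norm; lra.
have -> : (p18 R).[z] - c%:C =
   (2518960533409%:R / 40177919568117760%:R : R)%:C + h * (
   (- 3978623197639%:R / 14048223625216%:R : R)%:C + h * (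
   (- 1183810715459%:R / 79819452416%:R : R)%:C + h * (
   (- 28831697071%:R / 1814078464%:R : R)%:C + h * (
   (2466656679%:R / 82458112%:R : R)%:C + h * (
   (147341191%:R / 1874048%:R : R)%:C + h * (
   (1577841%:R / 21296%:R : R)%:C + h * (
   (17565%:R / 484%:R : R)%:C + h * (
   (409%:R / 44%:R : R)%:C + h * 1)))))))).
  by rewrite p18E /h /c /near_fixpoint; field.
(* Each constant is a rounded bound for the bracket multiplying [h] at that level. At the outermost
   level the constant term is below 0.00007, and 0.00007 + 0.36/200 < 1/500. *)
apply: (@normc_horner_step _ _ _ _ _ (36%:R / 100%:R) _ le_h);
  last by rewrite ger0_norm; lra.
apply: (@normc_horner_step _ _ _ _ _ 15%:R _ le_h);
  last by rewrite ler0_norm; lra.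
apply: (@normc_horner_step _ _ _ _ _ 17%:R _ le_h);
  last by rewrite ler0_norm; lra.
apply: (@normc_horner_step _ _ _ _ _ 31%:R _ le_h);
  last by rewrite ler0_norm; lra.
apply: (@normc_horner_step _ _ _ _ _ 80%:R _ le_h);
  last by rewrite ger0_norm; lra.
apply: (@normc_horner_step _ _ _ _ _ 75%:R _ le_h);
  last by rewrite ger0_norm; lra.
apply: (@normc_horner_step _ _ _ _ _ 37%:R _ le_h);
  last by rewrite ger0_norm; lra.
apply: (@normc_horner_step _ _ _ _ _ 10%:R _ le_h);
  last by rewrite ger0_norm; lra.
apply: (@normc_horner_step _ _ _ _ _ 1 _ le_h);
  last by rewrite ger0_norm; lra.
by rewrite normr1.
Qed.

Lemma iter_p18_trap (R : realType) (z : R[i]) (n : nat) :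
  let c := near_fixpoint R in
  `|z - c%:C| <= (500%:R^-1)%:C ->
  `|poly_iter (p18 R) n z - c%:C| <= (500%:R^-1)%:C.
Proof. by move=> c le_zc; elim: n => [//|n IH]; apply: p18_trap. Qed.

Lemma filled_julia_p18_not_sub_closure_U (R : realType) :
  ~ (filled_julia (p18 R) `<=` closure (U_set (p18 R))).
Proof.
pose c : R := near_fixpoint R.
have c_ge0 : 0 <= c by rewrite /c /near_fixpoint; lra.
have r_gt0 : 0 < (500%:R^-1)%:C :> R[i] by rewrite ltcR; lra.
have dist_c : `|c%:C - c%:C| <= (500%:R^-1)%:C :> R[i].
  by rewrite subrr normr0 ltW.
have norm_c : `|c%:C| = c%:C by rewrite normc_real ger0_norm.
move=> /(_ c%:C) sub; have {sub} : closure (U_set (p18 R)) c%:C.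
  apply: sub; rewrite /filled_julia /=.
  exists (c + 500%:R^-1)%:C; split; first by rewrite ger0_real // lecR; lra.
  move=> M lt_M n _ /=; apply: le_trans (ltW lt_M).
  rewrite -[poly_iter _ _ _](subrK c%:C) (le_trans (ler_normD _ _)) //.
  by rewrite norm_c rmorphD addrC lerD2l iter_p18_trap.
(* A point [w] of [U_set] in the ball around c would have an iterate both in the unit disc and
   within 1/500 of c, forcing c < 1 + 1/500. *)
move=> /(_ _ (nbhsx_ballx _ _ r_gt0))[w [[n _] w_U w_c]].
have /(iter_p18_trap _ _ n) le_wc : `|w - c%:C| <= (500%:R^-1)%:C :> R[i].
  by rewrite distrC ltW.
have : `|c%:C| < (1 + 500%:R^-1)%:C :> R[i].
  rewrite -[c%:C](subrK (poly_iter (p18 R) n w)) (le_lt_trans (ler_normD _ _)) //.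
  by rewrite rmorphD [ltLHS]addrC distrC ltr_leD.
by rewrite norm_c ltcR /c /near_fixpoint; lra.
Qed.

Theorem lemma5p1 (R : realType) :
  let k : seq int := [:: 1; -1; 1; 1; 1; -1; 1; -1; -1;
                         1; -1; 1; 1; 1; -1; 1; -1; 1] in
  let p : {poly R[i]} := p_poly R[i] k in
  [/\ sign_vector 18 k,
      p \in calS R[i],
      p = 'X^18 - 4 *: 'X^16 + 5 *: 'X^14 - 4 *: 'X^12 + 7 *: 'X^10
          - 8 *: 'X^8 + 6 *: 'X^6 - 4 *: 'X^4 + 'X^2 &
      ~ (filled_julia p `<=` closure (U_set p))].
Proof.
move=> k p.
have signs_k : sign_vector 18 k.
  by split=> // x; rewrite !inE; lia.
have pE : p = p18 R.
  rewrite /p /p18 (@p_polyE _ _ 14) //.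
  have -> : p_coefs k = [:: 0; 0; 1; 0; -4; 0; 6; 0;
                       -8; 0; 7; 0; -4; 0; 5; 0; -4; 0; 1].
    by vm_compute.
  by rewrite !ipoly_cons /ipoly /= -!mul_polyC !rmorph_nat; ring.
split; [by [] | | exact: pE |]; last first.
  by rewrite pE; apply: filled_julia_p18_not_sub_closure_U.
rewrite inE; exists 18%N, k; split; [by [] | by [] | by [] | | by []].
(* Invariance under [hat] holds already for the integer coefficient lists, where it is checked by
   evaluation. *)
by rewrite !(@p_polyE _ _ 14) //; congr ipoly; vm_compute.
Qed.
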